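(* (i) Let $a\ge 3$ be odd, let $D$ be a DM$(3;a)$ in standard form, and let $H$ be the matrix of Construction 1 on $D$. Then the $(a^2,4,a)$-regular binary LDPC code with parity-check matrix $H$ has rate $\displaystyle 1-\frac{4a-3}{a^2}$. (ii) Let $a\ge 4$ be even, let $D$ be a DCA$(3;a)$ in standard form, and let $\overline H$ be the matrix of Construction 2 on $D$. Then the $(a^2-a,4,\{a-1,a\})$-near regular binary LDPC code with parity-check matrix $\overline H$ has rate at least $\displaystyle 1-\frac{4a-6}{a^2-a}$.
   Context: All rows and columns of matrices are indexed starting from $0$. Difference matrix: for odd $a$, a DM$(3;a)$ is an $a\times 3$ array $D=[D(i,j)]$, $0\le i\le a-1$, $0\le j\le 2$, with entries in $\{0,\dots,a-1\}$, such that all entries of the first column ($j=0$) are $0$, each other column contains each of $0,\dots,a-1$ exactly once, and for all pairs of distinct columns $j\ne j'$, $\{D(i,j)-D(i,j') \bmod a \mid 0\le i\le a-1\}=\{0,\dots,a-1\}$. Difference covering array: for even $a$, a DCA$(3;a)$ is an $a\times 3$ array $D=[D(i,j)]$ with entries in $\{0,\dots,a-1\}$ such that all entries of the first column ($j=0$) are $0$, each other column contains each of $0,\dots,a-1$ exactly once, and for the distinct non-zero columns $j\ne j'$ the differences $D(i,j)-D(i,j')\bmod a$, $0\le i\le a-1$, are all non-zero and cover $\{1,\dots,a-1\}$. (Then exactly two rows $r$ satisfy $D(r,2)-D(r,1)\equiv a/2\pmod a$.) Either kind of array is in standard form if $D(i,1)=i$ for all $i$. For such an array $D$ let $I$ be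 the $a\times a$ identity matrix, let $P^i$ be the $a\times a$ $(0,1)$ circulant permutation matrix whose row $r$ has its unique entry $1$ in column $r-i\bmod a$, for $0\le v\le a-1$ let $R_v$ be the $a\times a$ matrix whose row $v$ is all ones and whose other rows are all zeros, and set $$M(D)=\begin{bmatrix} R_0&R_1&\cdots&R_{a-1}\\ I&I&\cdots&I\\ P^{D(0,1)}&P^{D(1,1)}&\cdots&P^{D(a-1,1)}\\ P^{D(0,2)}&P^{D(1,2)}&\cdots&P^{D(a-1,2)}\end{bmatrix}.$$ Construction 1 ($a$ odd, $D$ a DM$(3;a)$): $H=M(D)$, a $(4a)\times a^2$ matrix. Construction 2 ($a$ even, $D$ a DCA$(3;a)$): let $r_0$ be one (either one) of the two rows with $D(r_0,2)-D(r_0,1)\equiv a/2\pmod a$; $\overline H$ is the $(4a-1)\times(a^2-a)$ matrix obtained from $M(D)$ by deleting the block of $a$ columns corresponding to $v=r_0$ and then the resulting all-zero row $r_0$. The code with a given binary parity-check matrix with $m$ columns is its null space over $\mathbb{Z}_2$; $m$ is the length, and the rate is (dimension of the code over $\mathbb{Z}_2$)$/m$. Regular, respectively near regular, with the stated parameters means: length $m$ equal to the first parameter, all column weights $4$, and all row weights equal to $a$, respectively in $\{a-1,a\}$. *)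

(* Defs.v *)
From mathcomp Require Import all_boot all_order all_algebra.
Set Implicit Arguments.
Unset Strict Implicit.
Unset Printing Implicit Defensive.
Import GRing.Theory.
Local Open Scope ring_scope.

Section Arrays.
Variable a : nat.
Implicit Type D : 'M['I_a]_(a, 3).

Definition first_column_zero D := forall i, val (D i 0) = 0%N.

Definition other_columns_once D :=
  forall j, j != 0 -> forall x : 'I_a, #|[set i | D i j == x]| = 1%N.

Definition differences D (j j' : 'I_3) : seq int :=
  [seq (((D i j)%:Z - (D i j')%:Z) %% a)%Z | i : 'I_a].

(* [=i] on sequences is equality of the underlying sets. *)
Definition is_DM D :=
  [/\ first_column_zero D,
      other_columns_once D
    & forall j j', j != j' -> differences D j j' =i [seq k%:Z | k <- iota 0 a]].

Definition is_DCA D :=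
  [/\ first_column_zero D,
      other_columns_once D
    & forall j j', j != 0 -> j' != 0 -> j != j' ->
        differences D j j' =i [seq k%:Z | k <- iota 1 a.-1]].

Definition standard_form D := forall i, D i 1 = i.

Definition half_row D (r : 'I_a) :=
  ((D r 2%R)%:Z - (D r 1%R)%:Z = (a./2)%:Z %[mod a])%Z.

Definition Rmx (v : 'I_a) : 'M['F_2]_a := \matrix_(r, c) (r == v)%:R.

Definition Pmx (i : 'I_a) : 'M['F_2]_a :=
  \matrix_(r, c) (c%:Z == r%:Z - i%:Z %[mod a])%Z%:R.

(* The dimensions are those of [\mxblock]: [\sum_(k < 4) a] rows and
   [\sum_(v < a) a] columns. *)
Definition Mmx D := \mxblock_(k < 4, v < a)
  [:: Rmx v; 1%:M; Pmx (D v 1); Pmx (D v 2)]`_k.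

Definition construction1 D := Mmx D.

(* [lift r0] enumerates the block columns other than [r0], in order, and
   [tagnat.Rank 0 r0] is row [r0] of the top block row. *)
Definition construction2 D (r0 : 'I_a) :=
  row' (tagnat.Rank (0 : 'I_4) r0)
    (\mxrow_(v < a.-1) submxrow (Mmx D) (lift r0 v)).

End Arrays.

Section Codes.
Variables k m : nat.
Implicit Type H : 'M['F_2]_(k, m).

Definition code H : {vspace 'cV['F_2]_m} := lker (linfun (mulmx H)).

Lemma mem_code H x : (x \in code H) = (H *m x == 0).
Proof. by rewrite memv_ker lfunE. Qed.

Definition rate H : rat := (\dim (code H))%:R / m%:R.

Definition row_weight H i := #|[set j | H i j != 0]|.
Definition col_weight H j := #|[set i | H i j != 0]|.

Definition regular H (n wc wr : nat) :=
  [/\ m = n, forall j, col_weight H j = wc & forall i, row_weight H i = wr].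

Definition near_regular H (n wc : nat) (wr : seq nat) :=
  [/\ m = n, forall j, col_weight H j = wc & forall i, row_weight H i \in wr].

End Codes.

(* Main.v *)
Require Import Defs.
From mathcomp Require Import all_boot all_order all_algebra.
From mathcomp Require Import zify.
Import Order.TTheory GRing.Theory Num.Theory.
Set Implicit Arguments.
Unset Strict Implicit.
Unset Printing Implicit Defensive.
Local Open Scope ring_scope.

(** The rate of a binary code of length [m] is [1 - rank H / m]
([dim_code], [rateE]), so both claims are about the rank of the parity-check
matrix, and that rank is the number of rows minus the dimension of the space
of linear relations between the rows.

The column [(v, c)] of [M(D)] has exactly four ones: in block [k] it meets
row [hit D k v c], which is [v], [c], [c + D v 1], [c + D v 2] modulo [a] for
[k = 0, 1, 2, 3] ([MmxE]).  The weights follow by counting.  A relation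
between the rows is a family of functions [f_k : Z/a -> F_2] with
[f_0 v + f_1 c + f_2 (c + D v 1) + f_3 (c + D v 2) = 0] for all [v] and [c]
([mulmx_Mmx]).

When [a] is odd and [D] is a difference matrix, rows of distinct blocks share
exactly one column, i.e. the rows are the lines of a net with four parallel
classes.  Summing the relation over the [a] columns met by a fixed row [r] of
block [k] gives [a * f_k r], which is [f_k r], plus the total sums of the
three other functions, so every [f_k] is constant ([const_by_summation]).
Four constants with sum zero form a space of dimension 3, and the rank is
[4a - 3] ([rank_construction1]).

When [a] is even, the residue modulo 2 is an additive map from [Z/a] to
[F_2].  The three constant relations therefore come with two more, obtained
by reading modulo 2 the equations [D v 1 + c = c + D v 1] and
[D v 2 + c = c + D v 2].  Deleting the block of columns [r0] and the row [r0]
keeps these five relations, and keeps them independent, because blocks 1 to 3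
alone already separate them.  Hence the rank is at most
[(4a - 1) - 5 = 4a - 6] ([rank_construction2]). *)

(** * Dimension and rate of a binary code *)

(** Rank-nullity: a basis of the left kernel of [H^T], transposed, embeds
row vectors of coefficients linearly onto the code. *)
Lemma dim_code k m (H : 'M['F_2]_(k, m)) : \dim (code H) = (m - \rank H)%N.
Proof.
pose B := row_base (kermx H^T).
pose f := linfun (trmx \o mulmxr B : 'rV['F_2]_(\rank (kermx H^T)) -> 'cV['F_2]_m).
have fE u : f u = (u *m B)^T by rewrite lfunE.
have kerf : lker f == 0%VS.
  apply/lker0P => u v; rewrite !fE => /trmx_inj.
  by apply: row_free_inj; apply: row_base_free.
have imf : limg f = code H.
  apply/vspaceP => x; rewrite mem_code -trmx_eq0 trmx_mul -sub_kermx.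
  have -> : (x^T <= kermx H^T)%MS = (x^T <= B)%MS by rewrite eq_row_base.
  apply/memv_imgP/submxP => [[u _ ->]|[u xE]].
    by exists u; rewrite fE trmxK.
  by exists u; rewrite ?memvf // fE -xE trmxK.
rewrite -imf limg_dim_eq; last by rewrite (eqP kerf) capv0.
by rewrite dimvf dim_matrix [LHS]mul1n mxrank_ker mxrank_tr.
Qed.

Lemma rateE k m (H : 'M['F_2]_(k, m)) : (0 < m)%N ->
  rate H = 1 - (\rank H)%:R / m%:R.
Proof.
move=> m0; rewrite /rate dim_code natrB ?rank_leq_col // mulrBl divff //.
by rewrite pnatr_eq0 -lt0n.
Qed.

(** * Bits modulo 2 and short sums *)

Lemma bitF2_neq0 (b : bool) : (b%:R != 0 :> 'F_2) = b.
Proof. by case: b. Qed.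

Lemma addrr_F2 (x : 'F_2) : x + x = 0.
Proof. by rewrite addrr_pchar2 ?pchar_Fp. Qed.

Lemma sum_ord3 (R : nmodType) (F : 'I_3 -> R) : \sum_k F k = F 0 + F 1 + F 2.
Proof.
rewrite !big_ord_recl big_ord0 addr0 addrA.
by do !congr (_ + _); congr (F _); apply: val_inj.
Qed.

Lemma sum_ord4 (R : nmodType) (F : 'I_4 -> R) : \sum_k F k = F 0 + F 1 + F 2 + F 3.
Proof.
rewrite !big_ord_recl big_ord0 addr0 !addrA.
by do !congr (_ + _); congr (F _); apply: val_inj.
Qed.

Lemma sum_ord5 (R : nmodType) (F : 'I_5 -> R) : \sum_k F k = F 0 + F 1 + F 2 + F 3 + F 4.
Proof.
rewrite !big_ord_recl big_ord0 addr0 !addrA.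
by do !congr (_ + _); congr (F _); apply: val_inj.
Qed.

(** * Indices of a matrix with equal blocks *)

Section ConstantBlocks.
Context {b a : nat}.
Local Notation ordsum := 'I_(\sum_(k < b) a).
Local Notation Rank := (@tagnat.Rank b (fun=> a)).

Lemma sig2_Rank (k : 'I_b) (r : 'I_a) : tagnat.sig2 (Rank k r) = r.
Proof. by rewrite tagnat.Rank2K; apply: val_inj. Qed.

Lemma Rank_bij : bijective (fun p : 'I_b * 'I_a => Rank p.1 p.2).
Proof.
exists (fun s : ordsum => (tagnat.sig1 s, tagnat.sig2 s)) => [[k r]|s] /=.
  by rewrite tagnat.Rank1K sig2_Rank.
by rewrite tagnat.sig2K.
Qed.

Lemma big_Rank (R : nmodType) (F : ordsum -> R) :
  \sum_s F s = \sum_k \sum_r F (Rank k r).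
Proof.
by rewrite (reindex _ (onW_bij _ Rank_bij)) pair_bigA.
Qed.

Lemma card_Rank (P : pred ordsum) :
  #|[set s | P s]| = (\sum_k #|[set r | P (Rank k r)]|)%N.
Proof.
rewrite -sum1dep_card big_mkcond big_Rank; apply: eq_bigr => k _.
by rewrite -sum1dep_card [RHS]big_mkcond.
Qed.

End ConstantBlocks.

(** * Entries and weights of the first construction *)

Section Incidence.
Variable n : nat.
Local Notation a := n.+1.
Local Notation Rank := (@tagnat.Rank _ (fun=> a)).
Implicit Type D : 'M['I_a]_(a, 3).

(** In ['I_a] with [a] a successor, [x - y] is subtraction modulo [a]; this
is where the integer congruences of the definitions turn into equations. *)
Lemma val_subIp (x y : 'I_a) : ((x%:Z - y%:Z) %% a)%Z = (x - y)%R%:Z.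
Proof.
set z := (x - y)%R; have -> : z%:Z = (z%:Z %% a)%Z.
  by rewrite modz_nat modn_small.
apply/eqP; rewrite -(eqz_modDr y) subrK -PoszD !modz_nat eqz_nat.
by rewrite -{1}(subrK y x) /= modn_mod.
Qed.

Lemma PmxE (i r c : 'I_a) : Pmx i r c = (r == c + i)%:R.
Proof.
rewrite mxE -(eqz_modDr i) subrK -PoszD !modz_nat eqz_nat (modn_small (ltn_ord r)).
by rewrite eq_sym -val_eqE.
Qed.

(** The row of block [k] in which column [(v, c)] of [Mmx D] has its one. *)
Definition hit D (k : 'I_4) (v c : 'I_a) : 'I_a :=
  [:: v; c; c + D v 1; c + D v 2]`_k.

Lemma MmxE D (k : 'I_4) (r v c : 'I_a) :
  Mmx D (Rank k r) (Rank v c) = (r == hit D k v c)%:R.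
Proof.
rewrite mxE !tagnat.Rank1K !sig2_Rank /hit.
case: k => -[|[|[|[|//]]]] ltk /=; first by rewrite mxE.
- by rewrite mxE.
- by rewrite PmxE.
- by rewrite PmxE.
Qed.

Lemma mulmx_Mmx D m (W : 'M['F_2]_(m, _)) i v c :
  (W *m Mmx D) i (Rank v c) = \sum_k W i (Rank k (hit D k v c)).
Proof.
rewrite mxE big_Rank; apply: eq_bigr => k _.
rewrite (bigD1 (hit D k v c)) //= MmxE eqxx mulr1 [X in _ + X]big1 ?addr0 // => r /negPf neq.
by rewrite MmxE neq mulr0.
Qed.

(** In every block but the first, [c |-> hit D k v c] is a translation. *)
Lemma card_hit D (k : 'I_4) (v r : 'I_a) :
  #|[set c | r == hit D k v c]| = (if k == 0%R then a * (r == v) else 1)%N.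
Proof.
have [->|k0] := eqVneq.
  rewrite /hit /=; case: eqP => _; first by rewrite muln1 cardsT card_ord.
  by rewrite muln0; apply: eq_card0 => c; rewrite inE.
have [t ht] : exists t, forall c, hit D k v c = c + t.
  case: k k0 => -[|[|[|[|//]]]] ltk //= _; rewrite /hit /=.
  - by exists 0 => c; rewrite addr0.
  - by exists (D v 1).
  - by exists (D v 2).
rewrite -(cards1 (r - t)); apply: eq_card => c.
by rewrite !inE ht -subr_eq eq_sym.
Qed.

Lemma col_weight_Mmx D j : col_weight (Mmx D) j = 4.
Proof.
rewrite -(tagnat.sig2K j); move: (tagnat.sig1 j) (tagnat.sig2 j) => v c.
rewrite /col_weight card_Rank -[RHS]card_ord -sum1_card.
apply: eq_bigr => k _; rewrite -[RHS](cards1 (hit D k v c)).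
by apply: eq_card => r; rewrite !inE MmxE bitF2_neq0.
Qed.

Lemma row_weight_Mmx D i : row_weight (Mmx D) i = a.
Proof.
rewrite -(tagnat.sig2K i); move: (tagnat.sig1 i) (tagnat.sig2 i) => k r.
rewrite /row_weight card_Rank.
under eq_bigr => v _.
  under eq_finset => c do rewrite MmxE bitF2_neq0.
  rewrite card_hit; over.
case: eqP => _; last by rewrite sum_nat_const card_ord muln1.
rewrite (bigD1 r) //= eqxx muln1 big1 ?addn0 // => v.
by rewrite eq_sym => /negPf->; rewrite muln0.
Qed.

(** * Deleting a block of columns *)

Section DeletedBlock.
Variables (D : 'M['I_a]_(a, 3)) (r0 : 'I_a).
Local Notation h := (Rank (0 : 'I_4) r0).

Lemma construction2E i j :
  construction2 D r0 i j
  = Mmx D (lift h i) (Rank (lift r0 (tagnat.sig1 j)) (tagnat.sig2 j)).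
Proof. by rewrite mxE [LHS]mxE mxE. Qed.

Lemma deleted_row0 v c : Mmx D h (Rank (lift r0 v) c) = 0.
Proof. by rewrite MmxE /hit /= (negPf (neq_lift r0 v)). Qed.

(** The deleted row is zero on the remaining columns, so deleting it does not
change their weights. *)
Lemma col_weight_construction2 j : col_weight (construction2 D r0) j = 4.
Proof.
set J := Rank (lift r0 (tagnat.sig1 j)) (tagnat.sig2 j).
rewrite -[RHS](col_weight_Mmx D J) /col_weight -(card_imset _ (@lift_inj _ h)).
apply: eq_card => i; rewrite inE; apply/imsetP/idP => [[i' + ->]|].
  by rewrite inE construction2E.
case: (unliftP h i) => [i' -> nz|->]; last by rewrite deleted_row0 eqxx.
by exists i' => //; rewrite inE construction2E.
Qed.

Lemma row_weight_construction2 i :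
  row_weight (construction2 D r0) i \in [:: a.-1; a].
Proof.
have : lift h i != h by rewrite eq_sym neq_lift.
rewrite /row_weight; under eq_finset => j do rewrite construction2E.
rewrite -(tagnat.sig2K (lift h i)).
move: (tagnat.sig1 _) (tagnat.sig2 _) => k r neq.
rewrite card_Rank.
under eq_bigr => v _.
  under eq_finset => c do rewrite tagnat.Rank1K sig2_Rank MmxE bitF2_neq0.
  rewrite card_hit; over.
rewrite !inE; have [k0|_] := eqVneq k 0; last by rewrite sum_nat_const card_ord muln1 eqxx.
have: r != r0 by apply: contraNneq neq => ->; rewrite k0.
case: (unliftP r0 r) => [u -> _|->]; last by rewrite eqxx.
rewrite (bigD1 u) //= eqxx muln1 big1 ?addn0 ?eqxx ?orbT // => v.
by rewrite (inj_eq lift_inj) eq_sym => /negPf->; rewrite muln0.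
Qed.

(** The column of [W] that is dropped only ever multiplies the zero row. *)
Lemma mulmx_construction2 m (W : 'M['F_2]_(m, _)) i j :
  (col' h W *m construction2 D r0) i j
  = (W *m Mmx D) i (Rank (lift r0 (tagnat.sig1 j)) (tagnat.sig2 j)).
Proof.
rewrite !mxE [RHS](bigD1_ord h) //= deleted_row0 mulr0 add0r.
by apply: eq_bigr => k _; rewrite construction2E mxE.
Qed.

End DeletedBlock.

(** * Relations between the rows *)

(** Every column has one entry in each block, so the sum of all rows of block
0 equals the sum of all rows of block 1, 2 or 3.  Entry [k] of a list is the
coefficient given to the rows of block [k]. *)
Definition constant_relations : seq (seq 'F_2) :=
  [:: [:: 1; 1; 0; 0]; [:: 1; 0; 1; 0]; [:: 1; 0; 0; 1]].

Definition parity (x : 'I_a) : 'F_2 := x%:R.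

(** Coefficients of row [r] in each of the four blocks, in the relations that
are obtained from [c + D v j = D v j + c] modulo 2. *)
Definition parity_relations D (r : 'I_a) : seq (seq 'F_2) :=
  [:: [:: parity (D r 1); parity r; parity r; 0];
      [:: parity (D r 2); parity r; 0; parity r]].

Definition relmx m (g : 'I_a -> seq (seq 'F_2)) : 'M['F_2]_(m, \sum_(k < 4) a) :=
  \matrix_(i, j) (nth [::] (g (tagnat.sig2 j)) i)`_(tagnat.sig1 j).

Lemma relmxE m g i (k : 'I_4) (r : 'I_a) :
  relmx m g i (Rank k r) = (nth [::] (g r) i)`_k.
Proof. by rewrite mxE tagnat.Rank1K sig2_Rank. Qed.

(** Block [i + 1] has a nonzero coefficient in relation [i] only. *)
Lemma constant_relations_free : row_free (relmx 3 (fun=> constant_relations)).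
Proof.
apply: inj_row_free => u /rowP uE0; apply/rowP => i; rewrite mxE.
have := uE0 (Rank (lift 0 i) 0).
rewrite !mxE sum_ord3 !relmxE.
case: i => -[|[|[|//]]] lti /=; rewrite !(mulr0, mulr1, addr0, add0r) => <-;
  congr (u _ _); exact: val_inj.
Qed.

Lemma constant_relations_mul D : relmx 3 (fun=> constant_relations) *m Mmx D = 0.
Proof.
apply/matrixP => i j.
rewrite -(tagnat.sig2K j); move: (tagnat.sig1 j) (tagnat.sig2 j) => v c.
rewrite mulmx_Mmx mxE sum_ord4 !relmxE.
by case: i => -[|[|[|//]]] lti; apply: val_inj.
Qed.

(** * Rank for odd [a] *)

Lemma onto_inj (T : finType) (f : T -> T) :
  (forall y, exists x, f x = y) -> injective f.
Proof. by case/fin_all_exists => g gK; apply: can_inj (canF_sym gK). Qed.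

Lemma column_inj D (j : 'I_3) :
  other_columns_once D -> j != 0 -> injective (fun v => D v j).
Proof.
move=> once j0; apply: onto_inj => y; have /eqP/cards1P[v /setP/(_ v)] := once j j0 y.
by rewrite !inE eqxx => /eqP; exists v.
Qed.

Lemma difference_inj D (j j' : 'I_3) :
  differences D j j' =i [seq k%:Z | k <- iota 0 a] ->
  injective (fun v => D v j - D v j').
Proof.
move=> cover; apply: onto_inj => y.
have : y%:Z \in differences D j j'.
  by rewrite cover map_f // mem_iota ltn_ord.
by case/mapP => v _; rewrite val_subIp => -[yE]; exists v; apply: val_inj.
Qed.

(** The index [t] enumerates the columns met by row [r] of some block, and
[h1 r], [h2 r], [h3 r] give the rows met in the other blocks.  Sum over [t]:
as [a] is odd, [a] copies of [f r] add up to [f r], and each [h_i r] is a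
permutation, so the other three sums do not depend on [r]. *)
Lemma const_by_summation (f g1 g2 g3 : 'I_a -> 'F_2)
    (h1 h2 h3 : 'I_a -> 'I_a -> 'I_a) :
    odd a -> (forall r, injective (h1 r)) -> (forall r, injective (h2 r)) ->
    (forall r, injective (h3 r)) ->
    (forall r t, f r + g1 (h1 r t) + g2 (h2 r t) + g3 (h3 r t) = 0) ->
  forall r s, f r = f s.
Proof.
move=> odda i1 i2 i3 rel.
suff fE r : f r = - (\sum_t g1 t + \sum_t g2 t + \sum_t g3 t).
  by move=> r s; rewrite !fE.
apply/eqP; rewrite -addr_eq0.
have sumE (g : 'I_a -> 'F_2) (h : 'I_a -> 'I_a) : injective h -> \sum_t g t = \sum_t g (h t).
  by move=> hI; rewrite (reindex_inj hI).
rewrite (sumE g1 _ (i1 r)) (sumE g2 _ (i2 r)) (sumE g3 _ (i3 r)).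
have fa : f r = \sum_(t < a) f r.
  rewrite sumr_const card_ord -(odd_double_half a) odda mulrnDr mulr1n -mul2n.
  by rewrite mulrnA mulr2n addrr_F2 mul0rn addr0.
by rewrite fa !addrA -!big_split /= big1 // => t _; apply: rel.
Qed.

(** Summation along the rows of each block makes a relation constant on every
block.  For blocks 0, 1, 2, 3 the columns through a row are parametrised by
[c], [v], [v], [v]; the injectivity required of the other three coordinates
is that of [t], [p t] and [p t - t], where [p t = D t 2]. *)
Lemma kermx_Mmx_odd D : odd a -> is_DM D -> standard_form D ->
  \rank (kermx (Mmx D)) = 3.
Proof.
move=> odda [_ once diff] std.
have -> : (kermx (Mmx D) :=: relmx 3 (fun=> constant_relations))%MS; last first.
  exact/eqP/constant_relations_free.
apply/eqmxP/andP; split; last by rewrite sub_kermx constant_relations_mul.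
apply/row_subP => i; set x := row i _.
have xM : x *m Mmx D = 0 by apply/sub_kermxP; apply: row_sub.
clearbody x.
pose f k r := x 0 (Rank k r).
pose p v := D v 2.
have rel v c : f 0 v + f 1 c + f 2 (c + v) + f 3 (c + p v) = 0.
  have := congr1 (fun A : 'rV_ _ => A 0 (Rank v c)) xM.
  rewrite /= mulmx_Mmx mxE sum_ord4 => <-.
  by rewrite /f /hit /= std.
have pI : injective p by apply: column_inj.
have dI : injective (fun v => p v - v).
  by move=> v w; have := @difference_inj D 2 1 (diff 2 1 isT) v w; rewrite /= !std.
(* Row r of block 0 meets the columns (r, t). *)
have f0 : forall r s, f 0 r = f 0 s.
  apply: (@const_by_summation _ (f 1) (f 2) (f 3) (fun=> id)
            (fun r t => t + r) (fun r t => t + p r) odda) => //.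
  - by move=> r; apply: inj_id.
  - by move=> r; apply: addIr.
  - by move=> r; apply: addIr.
(* Row r of block 1 meets the columns (t, r). *)
have f1 : forall r s, f 1 r = f 1 s.
  apply: (@const_by_summation _ (f 0) (f 2) (f 3) (fun=> id)
            (fun r t => r + t) (fun r t => r + p t) odda) => //.
  - by move=> r; apply: inj_id.
  - by move=> r; apply: addrI.
  - by move=> r v w /addrI /pI.
  - by move=> r t; rewrite [f 1 r + _]addrC.
(* Row r of block 2 meets the columns (t, r - t). *)
have f2 : forall r s, f 2 r = f 2 s.
  apply: (@const_by_summation _ (f 0) (f 1) (f 3) (fun=> id)
            (fun r t => r - t) (fun r t => r + (p t - t)) odda) => //.
  - by move=> r; apply: inj_id.
  - by move=> r v w /addrI /oppr_inj.
  - by move=> r v w /addrI /dI.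
  - move=> r t; have := rel t (r - t); rewrite subrK => <-.
    by congr (_ + f 3 _); [rewrite -addrA addrC | rewrite addrA addrAC].
(* Row r of block 3 meets the columns (t, r - p t). *)
have f3 : forall r s, f 3 r = f 3 s.
  apply: (@const_by_summation _ (f 0) (f 1) (f 2) (fun=> id)
            (fun r t => r - p t) (fun r t => r - (p t - t)) odda) => //.
  - by move=> r; apply: inj_id.
  - by move=> r v w /addrI /oppr_inj /pI.
  - by move=> r v w /addrI /oppr_inj /dI.
  - move=> r t; have := rel t (r - p t); rewrite subrK => <-.
    have -> : r - (p t - t) = r - p t + t by rewrite opprB addrA addrAC.
    by rewrite [RHS]addrC !addrA.
have sum0 : f 0 0 = f 1 0 + f 2 0 + f 3 0.
  have /eqP := rel 0 0; rewrite !add0r (f3 (p 0) 0) -!addrA addr_eq0 => /eqP->.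
  by rewrite !addrA; apply/eqP; rewrite eq_sym -addr_eq0 addrr_F2.
have fE (k : 'I_4) (r : 'I_a) : f k r = [:: f 0 0; f 1 0; f 2 0; f 3 0]`_k.
  have ordE (l : 'I_4) : k = l :> nat -> k = l by exact: val_inj.
  case: k ordE => -[|[|[|[|//]]]] ltk ordE /=.
  - by rewrite (ordE 0 erefl) (f0 r 0).
  - by rewrite (ordE 1 erefl) (f1 r 0).
  - by rewrite (ordE 2 erefl) (f2 r 0).
  - by rewrite (ordE 3 erefl) (f3 r 0).
apply/submxP; exists (\row_i [:: f 1 0; f 2 0; f 3 0]`_i).
apply/rowP => j; rewrite -(tagnat.sig2K j).
move: (tagnat.sig1 j) (tagnat.sig2 j) => k r.
rewrite !mxE sum_ord3 !relmxE !mxE -/(f k r) fE.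
by case: k {r} => -[|[|[|[|//]]]] ltk /=;
  rewrite !(mulr0, mulr1, addr0, add0r) ?sum0.
Qed.

(** * Rank bound for even [a] *)

Lemma parityD : ~~ odd a -> {morph parity : x y / x + y >-> x + y}.
Proof.
move=> evena x y; have a0 : a%:R = 0 :> 'F_2.
  rewrite -(odd_double_half a) (negPf evena) add0n -addnn natrD.
  exact: addrr_F2.
by rewrite /parity -natrD [in RHS](divn_eq (x + y) a) natrD natrM a0 mulr0 add0r.
Qed.

Definition even_relations D r := constant_relations ++ parity_relations D r.

Lemma even_relations_mul D : ~~ odd a ->
  relmx 5 (even_relations D) *m Mmx D = 0.
Proof.
move=> evena; apply/matrixP => i j.
rewrite -(tagnat.sig2K j); move: (tagnat.sig1 j) (tagnat.sig2 j) => v c.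
rewrite mulmx_Mmx mxE sum_ord4 !relmxE.
case: i => -[|[|[|[|[|//]]]]] lti; rewrite /hit /= ?(parityD evena);
  by rewrite !addr0 ?[parity c + parity (D v _)]addrC addrr_F2.
Qed.

(** The deleted row lies in block 0 and the other blocks determine the
coefficients: block 3 at rows 0 and 1 gives those of relations 2 and 4, block
2 those of relations 1 and 3, and block 1 then that of relation 0. *)
Lemma even_relations_free D r0 : (1 < a)%N ->
  row_free (col' (Rank (0 : 'I_4) r0) (relmx 5 (even_relations D))).
Proof.
move=> a1; apply: inj_row_free => u /rowP uE0.
have uE (k : 'I_4) (r : 'I_a) : k != 0 ->
    \sum_s u 0 s * (nth [::] (even_relations D r) s)`_k = 0.
  move=> k0; case: (unliftP (Rank (0 : 'I_4) r0) (Rank k r)) => [j jE|E].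
    have := uE0 j; rewrite !mxE; apply: etrans; apply: eq_bigr => s _.
    by rewrite mxE -jE relmxE.
  by move/(congr1 tagnat.sig1): E k0; rewrite !tagnat.Rank1K => ->.
have p0 : parity 0 = 0 by [].
have p1 : parity (inord 1) = 1 by rewrite /parity inordK.
have u2 := uE 3 0 isT.
have u4 := uE 3 (inord 1) isT.
have u1 := uE 2 0 isT.
have u3 := uE 2 (inord 1) isT.
have u0 := uE 1 0 isT.
move: u0 u1 u2 u3 u4.
rewrite !sum_ord5 /= p0 p1 !(mulr0, mulr1, addr0, add0r).
move=> u0 u1 u2; rewrite u1 u2 !add0r => u3 u4; apply/rowP => i; rewrite mxE.
have ordE (l : 'I_5) : i = l :> nat -> i = l by exact: val_inj.
case: i ordE => -[|[|[|[|[|//]]]]] lti ordE.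
- by rewrite (ordE 0 erefl).
- by rewrite (ordE 1 erefl).
- by rewrite (ordE 2 erefl).
- by rewrite (ordE 3 erefl).
- by rewrite (ordE 4 erefl).
Qed.

Lemma rank_construction1 D : odd a -> is_DM D -> standard_form D ->
  \rank (construction1 D) = (4 * a - 3)%N.
Proof.
move=> odda DM std; have := mxrank_ker (Mmx D).
rewrite kermx_Mmx_odd //; have := rank_leq_row (Mmx D).
rewrite /construction1; move: (\rank _) => rk; rewrite sum_nat_const card_ord; lia.
Qed.

Lemma rank_construction2 D r0 : (1 < a)%N -> ~~ odd a ->
  (\rank (construction2 D r0) <= 4 * a - 6)%N.
Proof.
move=> a1 evena; have := mxrank_ker (construction2 D r0).
have : (5 <= \rank (kermx (construction2 D r0)))%N.
  have /eqP <- := even_relations_free D r0 a1.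
  apply/mxrankS/sub_kermxP/matrixP => i j.
  by rewrite mulmx_construction2 even_relations_mul // !mxE.
have := rank_leq_row (construction2 D r0).
move: (\rank (kermx _)) (\rank _) => ker rk; rewrite sum_nat_const card_ord; lia.
Qed.

End Incidence.

(** * Rates of the two codes *)

Theorem lemma8 :
  (forall (a : nat) (D : 'M['I_a]_(a, 3)),
     (3 <= a)%N -> odd a -> is_DM D -> standard_form D ->
     regular (construction1 D) (a ^ 2) 4 a /\
     rate (construction1 D) = 1 - (4 * a%:R - 3) / a%:R ^+ 2)
  /\
  (forall (a : nat) (D : 'M['I_a]_(a, 3)) (r0 : 'I_a),
     (4 <= a)%N -> ~~ odd a -> is_DCA D -> standard_form D ->
     half_row D r0 ->
     near_regular (construction2 D r0) (a ^ 2 - a) 4 [:: a.-1; a] /\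
     1 - (4 * a%:R - 6) / (a%:R ^+ 2 - a%:R) <= rate (construction2 D r0)).
Proof.
split=> [[//|n] D a3 odda DM std | [//|n] D r0 a4 evena DCA std half].
  have mE : (\sum_(v < n.+1) n.+1 = n.+1 ^ 2)%N.
    by rewrite sum_nat_const card_ord mulnn.
  split; first by split=> //; [apply: col_weight_Mmx | apply: row_weight_Mmx].
  rewrite rateE ?rank_construction1 // mE ?expn_gt0 //.
  by rewrite natrX natrB ?natrM //; lia.
have mE : (\sum_(v < n) n.+1 = n.+1 ^ 2 - n.+1)%N.
  by rewrite sum_nat_const card_ord -mulnn mulSn addKn.
have m0 : (0 < n.+1 ^ 2 - n.+1)%N by rewrite -mE sum_nat_const card_ord; lia.
split.
  by split=> //; [apply: col_weight_construction2 | apply: row_weight_construction2].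
have : (\rank (construction2 D r0) <= 4 * n.+1 - 6)%N.
  by apply: rank_construction2 => //; lia.
(* The rank is generalised because its type mentions the length. *)
rewrite rateE ?mE //; move: (\rank _) => rk rk_le.
rewrite mE -natrX -natrB; last by lia.
rewrite lerD2l lerN2 ler_pM2r ?invr_gt0 ?ltr0n //.
have le64 : (6 <= 4 * n.+1)%N by lia.
by rewrite -natrM -natrB // ler_nat.
Qed.
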